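(* Let $d\ge 1$, and let $\mathbb V^d$, $\mathbb G^d$ and the product $\phi\cdot\psi$ of $\phi\in\mathbb G^d$ and $\psi\in\mathbb V^d$ be as defined in the context. For each fixed $K\in\mathscr K^d$: (i) $(\phi,\psi)\mapsto(\phi\cdot\psi)(K)$ is a bilinear map from $\mathbb G^d\times\mathbb V^d$ to $\mathbb R$; (ii) $(\phi\cdot\psi)(K)=(\psi\cdot\phi)(K)$ for all $\phi,\psi\in\mathbb G^d$; (iii) $(\chi\cdot\psi)(K)=\psi(K)$ for all $\psi\in\mathbb V^d$, where $\chi$ is the Euler characteristic. For each fixed $\phi\in\mathbb G^d$ and $\psi\in\mathbb V^d$: (iv) $K\mapsto(\phi\cdot\psi)(K)$ is a $\sigma$-continuous valuation, i.e. the product maps $\mathbb G^d\times\mathbb V^d$ into $\mathbb V^d$; moreover, $(\phi\cdot\psi)(\{x\})=\phi(\{x\})\,\psi(\{x\})$ for each $x\in\mathbb R^d$; (v) if $\psi\in\mathbb G^d$, then $\phi\cdot\psi\in\mathbb G^d$ as well; more precisely, if $\phi$ is defined by $N,(\alpha_n),(C_n)$ and $\psi$ by $N',(\alpha'_m),(C'_m)$, then $\phi\cdot\psi$ is defined by the $NN'$ coefficients $\alpha_n\alpha'_m$ and sets $C_n\cap C'_m$, $1\le n\le N$, $1\le m\le N'$ (where pairs with $C_n\cap C'_m=\emptyset$ contribute zero and are omitted), i.e. $(\phi\cdot\psi)(K)=\sum_{n,m}\alpha_n\alpha'_m\,\chi(K\cap C_n\cap C'_m)$ for all $K\in\mathscr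 K^d$.
   Context: $\mathscr K^d$ is the family of all compact convex subsets of $\mathbb R^d$, including the empty set. A valuation is a map $\phi:\mathscr K^d\to\mathbb R$ with $\phi(\emptyset)=0$ and $\phi(K\cup L)+\phi(K\cap L)=\phi(K)+\phi(L)$ for all $K,L\in\mathscr K^d$ such that $K\cup L$ is convex. It is $\sigma$-continuous if $\phi(K_n)\to\phi(K)$ for every sequence $(K_n)$ in $\mathscr K^d$ with $K_n\downarrow K$ (decreasing with intersection $K$). The Euler characteristic is $\chi(K)=1$ if $K\ne\emptyset$, $\chi(\emptyset)=0$. $\mathbb V^d$ is the real vector space of all $\sigma$-continuous (real-valued) valuations on $\mathscr K^d$. A valuation $\phi$ is countably generated if there exist $N\in\mathbb N\cup\{0,\infty\}$, a family of $N$ nonempty closed convex sets $C_n\subset\mathbb R^d$ that is locally finite (each $K\in\mathscr K^d$ meets only finitely many of the $C_n$), and $N$ real numbers $\alpha_n$ such that $$\phi(K)=\sum_{n=1}^N\alpha_n\,\chi(K\cap C_n),\quad K\in\mathscr K^d;$$ in this case $\phi$ is said to be defined by $N,(\alpha_n),(C_n)$. $\mathbb G^d\subset\mathbb V^d$ is the subspace of countably generated valuations. For $\psi\in\mathbb V^d$ and $\phi\in\mathbb G^d$ defined by $N,(\alpha_n),(C_n)$, the product is $$(\phi\cdot\psi)(K)=\sum_{n=1}^N\alpha_n\,\psi(K\cap C_n),\quad K\in\mathscr K^d.$$ For each $K$ only finitely many terms are nonzero, and the value does not depend on the choice of the representation $N,(\alpha_n),(C_n)$ of $\phi$, so the product is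 well defined. *)

(* Defs.v *)
From HB Require Import structures.
From mathcomp Require Export all_boot all_order all_algebra.
From mathcomp Require Export all_classical all_reals all_analysis.
Export Order.TTheory GRing.Theory Num.Theory numFieldNormedType.Exports.

Set Implicit Arguments.
Unset Strict Implicit.
Unset Printing Implicit Defensive.

Local Open Scope classical_set_scope.
Local Open Scope ring_scope.

Section ConvexSets.
Context {R : realType} {d : nat}.
Implicit Types (A B : set 'rV[R]_d).

Record convex_body := ConvexBody {
  body_set :> set 'rV[R]_d;
  body_compact : compact body_set;
  body_convex : convex_set body_set }.

(* The empty set is allowed here; [defined_by] below asks for nonemptiness. *)
Record closed_convex := ClosedConvex {
  cc_set :> set 'rV[R]_d;
  cc_closed : closed cc_set;
  cc_convex : convex_set cc_set }.

Lemma convex_set0 : convex_set (set0 : set 'rV[R]_d).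
Proof. by move=> x y l; rewrite inE. Qed.

Lemma convex_set1 (x : 'rV[R]_d) : convex_set [set x].
Proof. by move=> y z l; rewrite !inE => -> ->; rewrite convmm. Qed.

Lemma convex_setI A B : convex_set A -> convex_set B -> convex_set (A `&` B).
Proof.
move=> cA cB x y l; rewrite !inE => -[Ax Bx] [Ay By]; split.
- by have /set_mem := cA x y l (mem_set Ax) (mem_set Ay).
- by have /set_mem := cB x y l (mem_set Bx) (mem_set By).
Qed.

Lemma compact_setI A B : compact A -> compact B -> compact (A `&` B).
Proof.
move=> cA cB; apply: compact_closedI => //.
exact: compact_closed (@norm_hausdorff _ _) cB.
Qed.

Definition body0 : convex_body := ConvexBody (@compact0 _) convex_set0.

Definition body1 (x : 'rV[R]_d) : convex_body :=
  ConvexBody (@compact_set1 _ x) (@convex_set1 x).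

Definition bodyI (K L : convex_body) : convex_body :=
  ConvexBody (compact_setI (@body_compact K) (@body_compact L))
             (convex_setI (@body_convex K) (@body_convex L)).

Definition bodyU (K L : convex_body) (KL : convex_set (K `|` L)) :
    convex_body :=
  ConvexBody (compactU (@body_compact K) (@body_compact L)) KL.

Definition bodyIc (K : convex_body) (C : closed_convex) : convex_body :=
  ConvexBody (compact_closedI (@body_compact K) (@cc_closed C))
             (convex_setI (@body_convex K) (@cc_convex C)).

Definition ccI (C C' : closed_convex) : closed_convex :=
  ClosedConvex (closedI (@cc_closed C) (@cc_closed C'))
               (convex_setI (@cc_convex C) (@cc_convex C')).

End ConvexSets.
Arguments convex_body : clear implicits.
Arguments closed_convex : clear implicits.

Section Valuations.
Context {R : realType} {d : nat}.
Implicit Types (K L : convex_body R d) (phi psi : convex_body R d -> R).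

Definition valuation phi : Prop :=
  phi body0 = 0 /\
  forall K L (KL : convex_set (K `|` L)),
    phi (bodyU KL) + phi (bodyI K L) = phi K + phi L.

Definition sigma_continuous phi : Prop :=
  forall (K_ : nat -> convex_body R d) K,
    (forall n m, (n <= m)%N -> K_ m `<=` K_ n) ->
    \bigcap_n K_ n = K ->
    phi (K_ n) @[n --> \oo] --> phi K.

Definition VV : set (convex_body R d -> R) :=
  [set phi | valuation phi /\ sigma_continuous phi].

Definition euler K : R := `[< K !=set0 >]%:R.

(* [phi] is defined by the coefficients [alpha i] and the sets [C i], where
   [i] runs over the subset [D] of [I]; the values of [alpha] and [C]
   outside [D] play no role.  By local finiteness the finitely supported
   sum below has only finitely many nonzero terms. *)
Definition defined_by (I : choiceType) (D : set I) (alpha : I -> R)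
    (C : I -> closed_convex R d) phi : Prop :=
  [/\ forall i, D i -> C i !=set0,
      forall K, finite_set [set i | D i /\ (K `&` C i) !=set0] &
      forall K, phi K = \sum_(i \in D) alpha i * euler (bodyIc K (C i))].

(* The index set of a family of [N] elements, [N] a natural number or
   infinity ([None]); indices start from 0. *)
Definition indices (N : option nat) : set nat :=
  if N is Some k then `I_k else setT.

Definition countably_generated phi : Prop :=
  exists (N : option nat) (alpha : nat -> R) (C : nat -> closed_convex R d),
    defined_by (indices N) alpha C phi.

Definition GG : set (convex_body R d -> R) :=
  [set phi | VV phi /\ countably_generated phi].

(* The value at [K] is the number that the defining sum takes for every
   representation of [phi]. *)
Definition product phi psi : convex_body R d -> R := fun K =>
  xget 0 [set v | forall N alpha C, defined_by (indices N) alpha C phi ->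
    v = \sum_(n \in indices N) alpha n * psi (bodyIc K (C n))].

End Valuations.
Arguments VV : clear implicits.
Arguments GG : clear implicits.

(* Main.v *)
From HB Require Import structures.
Require Import Defs.
From mathcomp Require Import ring lra.

Set Implicit Arguments.
Unset Strict Implicit.
Unset Printing Implicit Defensive.

(* The point is that [product] is well defined, i.e. Groemer's theorem: a
   linear relation [\sum_i a_i 1_(K_i) = 0] between indicators of convex bodies
   implies [\sum_i a_i psi(K_i) = 0] for every sigma-continuous valuation [psi].
   No induction on the dimension is needed, only one on the number of bodies.
   Cut the relation by a half-space [H+] containing a fixed [L = K_1] in its
   interior: the relations restricted to the complementary half-space [H-] and
   to [H+ /\ H-] lose the body [K_1], so by induction [psi] annihilates them,
   and additivity of [psi] lets each [K_i] be replaced by [K_i /\ H+].  Since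
   [L] is a countable intersection of such half-spaces, sigma-continuity lets
   each [K_i] be replaced by [K_i /\ K_1].  Doing this for [K_1] and then for
   [K_2 /\ K_1] makes two bodies of the relation equal; merging them shortens
   it. *)

Local Open Scope classical_set_scope.
Local Open Scope ring_scope.

(** * Half-spaces that separate a convex body from points *)

Section Separation.
Context {R : realType} {d : nat}.
Implicit Types (u v x y z : 'rV[R]_d) (L : convex_body R d).

Definition dot u x : R := \sum_i u 0 i * x 0 i.

Lemma dotDr u x y : dot u (x + y) = dot u x + dot u y.
Proof. by rewrite -big_split; apply: eq_bigr => i _; rewrite mxE mulrDr. Qed.

Lemma dotZr u a x : dot u (a *: x) = a * dot u x.
Proof. by rewrite mulr_sumr; apply: eq_bigr => i _; rewrite mxE mulrCA. Qed.

Lemma dotC u x : dot u x = dot x u.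
Proof. by apply: eq_bigr => i _; rewrite mulrC. Qed.

Lemma dot0l x : dot 0 x = 0.
Proof. by rewrite /dot big1// => i _; rewrite mxE mul0r. Qed.

Lemma dotNl u x : dot (- u) x = - dot u x.
Proof. by rewrite dotC -scaleN1r dotZr mulN1r dotC. Qed.

Lemma dotBr u x y : dot u (x - y) = dot u x - dot u y.
Proof. by rewrite dotDr -scaleN1r dotZr mulN1r. Qed.

Lemma dot_sqrB u t x :
  dot (u - t *: x) (u - t *: x) = dot u u - 2 * t * dot u x + t ^+ 2 * dot x x.
Proof.
rewrite dotBr dotC dotBr dotZr (dotC _ (t *: x)) dotBr.
by rewrite !(dotZr, dotC (t *: x)); ring.
Qed.

Lemma dot_ge0 u : 0 <= dot u u.
Proof. by apply: sumr_ge0 => i _; rewrite -expr2 sqr_ge0. Qed.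

Lemma dot_eq0 u : (dot u u == 0) = (u == 0).
Proof.
apply/eqP/eqP => [/eqP|->]; last by rewrite dot0l.
rewrite psumr_eq0 => [/allP u0|i _]; last by rewrite -expr2 sqr_ge0.
apply/rowP => i; rewrite mxE; apply/eqP.
by have := u0 i (mem_index_enum i); rewrite mulf_eq0 orbb.
Qed.

Lemma convE l x y :
  conv l (x : convex_lmodType 'rV[R]_d) y = l%:num *: x + (1 - l%:num) *: y.
Proof. by []. Qed.

Lemma cvg_sumr {T : Type} (F : set_system T) {FF : Filter F} {I : Type}
    (r : seq I) (f : I -> T -> R) (a : I -> R) :
  (forall i, f i x @[x --> F] --> a i) ->
  \sum_(i <- r) f i x @[x --> F] --> \sum_(i <- r) a i.
Proof.
by move=> fa; apply: cvg_big => [|i _]; [exact: add_continuous|exact: fa].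
Qed.

Lemma dot_continuous (f g : 'rV[R]_d -> 'rV[R]_d) :
  continuous f -> continuous g -> continuous (fun x => dot (f x) (g x)).
Proof.
move=> cf cg x; apply: (@cvg_sumr _ (nbhs x)) => i.
have coord (h : 'rV[R]_d -> 'rV[R]_d) : continuous h ->
    h y 0 i @[y --> x] --> (h x 0 i : R).
  move=> ch; apply: (@continuous_comp _ _ _ h (fun M => M 0 i) x (ch x)).
  exact: coord_continuous.
by apply: cvgM; exact: coord.
Qed.

(** The normal [u] joins [x] to its nearest point [p] in [L]: if some [y] in [L] lay beyond the
    hyperplane through [p], the segment from [p] to [y] would contain points closer to [x]. *)
Lemma separation L x : ~ body_set L x ->
  exists u a, (forall y, body_set L y -> dot u y <= a) /\ a < dot u x.
Proof.
move=> Lx; have [/set0P L0|/negP] := boolP (L != set0 :> set _); last first.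
  move=> /negP/negPn/eqP L0; exists 0, (-1); split=> [y|]; first by rewrite L0.
  by rewrite dot0l ltrN10.
have sub_cont : continuous (fun y => x - y).
  by move=> y; apply: (@cvgB _ _ _ (nbhs y)); [exact: cvg_cst|exact: cvg_id].
have [p /set_mem Lp pmin] := compact_EVT_min L0 (@body_compact _ _ L)
  (continuous_subspaceT (dot_continuous sub_cont sub_cont)).
set u := x - p in pmin.
have u_gt0 : 0 < dot u u.
  rewrite lt_neqAle dot_ge0 andbT eq_sym dot_eq0 subr_eq0.
  by apply: contra_notN Lx => /eqP ->.
exists u, (dot u p); split=> [y Ly|]; last first.
  by have : dot u u = dot u x - dot u p := dotBr u x p; lra.
rewrite -subr_le0 -dotBr.
rewrite leNgt; apply/negP => a_gt0; set a := dot u (y - p) in a_gt0.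
set b := dot (y - p) (y - p).
have b_ge0 : 0 <= b := dot_ge0 _.
(* For t = a / (a + b) the squared distance changes by - 2 t a + t^2 b = - t a - t^2 a < 0. The
   exact minimiser a / b could exceed 1. *)
have t0 : 0 <= a / (a + b) by rewrite divr_ge0// ?addr_ge0// ltW.
have t1 : a / (a + b) <= 1 by rewrite ler_pdivrMr; lra.
have /pmin := @body_convex _ _ L y p (Itv01 t0 t1) (mem_set Ly) (mem_set Lp).
rewrite convE /=; set t := a / (a + b) in t0 t1 *.
have -> : x - (t *: y + (1 - t) *: p) = u - t *: (y - p).
  by apply/rowP => i; rewrite !mxE; ring.
rewrite dot_sqrB -/a -/b.
have : t * (a + b) = a by rewrite divfK//; lra.
nra.
Qed.

Lemma rat_approx u e : 0 < e ->
  exists v : 'rV[rat]_d, forall i, `|ratr (v 0 i) - u 0 i| <= e.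
Proof.
move=> e0; have q i : exists q : rat, `|ratr q - u 0 i| <= e.
  have [|q] := @rat_in_itvoo R (u 0 i) (u 0 i + e); first by rewrite ltrDl.
  rewrite in_itv/= => /andP[uq qu]; exists q.
  by rewrite ger0_norm ?subr_ge0 1?ltW// ltrBlDl.
have [f fE] := choice q; exists (\row_i f i) => i; rewrite mxE; exact: fE.
Qed.

Lemma dot_approx u v e M x : (forall i, `|v 0 i - u 0 i| <= e) -> `|x| <= M ->
  `|dot v x - dot u x| <= d%:R * (e * M).
Proof.
move=> uv xM; rewrite /dot -sumrB.
rewrite (le_trans (ler_norm_sum _ _ _))//.
have -> : d%:R * (e * M) = \sum_(i < d) e * M.
  by rewrite sumr_const card_ord mulr_natl.
apply: ler_sum => i _; rewrite -mulrBl normrM ler_pM//.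
(* The norm on row vectors is the maximum norm, so it bounds every coordinate. *)
rewrite (le_trans _ xM)// [leRHS]/Num.norm/= mx_normrE.
by apply/bigmax_geP; right; exists (0, i).
Qed.

Definition qdot (v : 'rV[rat]_d) x : R := dot (map_mx ratr v) x.

(* Rational data leave only countably many half-spaces, so that
   sigma-continuity applies to their intersection. *)
Lemma rat_separation L x : ~ body_set L x ->
  exists (v : 'rV[rat]_d) (c : rat),
    (forall y, body_set L y -> qdot v y < ratr c) /\ ratr c < qdot v x.
Proof.
move=> Lx; have [u [a [Lu ux]]] := separation Lx.
have [M [M0 LM xM]] : exists M : R,
    [/\ 0 < M, forall y, body_set L y -> `|y| <= M & `|x| <= M].
  have [B [_ LB]] := compact_bounded (@body_compact _ _ L).
  exists (`|B| + 1 + `|x|); split=> [|y Ly|]; last by rewrite lerDr.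
    by rewrite ltr_wpDr// ltr_wpDl.
  rewrite (@le_trans _ _ (`|B| + 1)) ?lerDl//; apply: LB => //.
  by rewrite (le_lt_trans (ler_norm _))// ltrDl.
(* On the ball of radius [M], replacing [u] by [v] then costs at most a quarter of the gap
   [dot u x - a], which leaves an interval for [c]. Writing [d.+1] keeps the denominator positive
   when [d] is 0. *)
set e := (dot u x - a) / (4 * (d.+1%:R * M)).
have dM0 : 0 < d.+1%:R * M by rewrite mulr_gt0.
have e0 : 0 < e by rewrite divr_gt0 ?subr_gt0// mulr_gt0.
have [v uv] := rat_approx u e0.
have near z : `|z| <= M -> `|qdot v z - dot u z| <= (dot u x - a) / 4.
  move=> zM; apply: le_trans (dot_approx (u := u) _ zM) _.
    by move=> i; rewrite mxE; exact: uv.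
  have -> : (dot u x - a) / 4 = d.+1%:R * (e * M).
    by rewrite /e; field; rewrite !gt_eqF// ltr0n.
  by rewrite ler_wpM2r ?ler_nat// mulr_ge0// ltW.
have [|c] := @rat_in_itvoo R (a + (dot u x - a) / 4)
  (dot u x - (dot u x - a) / 4); first by lra.
rewrite in_itv/= => /andP[ac cx]; exists v, c; split=> [y Ly|].
  have /near := LM _ Ly; have := Lu _ Ly.
  by rewrite ler_norml => ? /andP[]; lra.
by have := near _ xM; rewrite ler_norml => /andP[]; lra.
Qed.

(** The strict inequality on [L] makes the complementary closed half-spaces, with their bounding
    hyperplanes, disjoint from [L]. *)
Lemma halfspaces L : exists (u : nat -> 'rV[R]_d) (c : nat -> R),
  (forall n y, body_set L y -> dot (u n) y < c n) /\
  (forall x, (forall n, dot (u n) x <= c n) -> body_set L x).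
Proof.
pose P (p : 'rV[rat]_d * rat) :=
  forall y, body_set L y -> qdot p.1 y < ratr p.2.
(* Numbers that encode no half-space around [L] receive the pair (0, 1), which cuts out the whole
   space. *)
pose s n := if unpickle n is Some p then
  if `[< P p >] then (map_mx ratr p.1, ratr p.2) else (0, 1)
  else (0 : 'rV[R]_d, 1 : R).
exists (fst \o s), (snd \o s); split=> [n y Ly|x sx].
  rewrite /s/=; case: unpickle => [p|]; last by rewrite dot0l.
  by case: asboolP => [/(_ y Ly)//|_]; rewrite dot0l.
apply: contrapT => /rat_separation[v [c [Lv cx]]].
have := sx (pickle (v, c)); rewrite /s/= pickleK; case: asboolP => //= _.
by rewrite leNgt cx.
Qed.

End Separation.

(** * Linear relations between indicators of convex bodies *)

Section Groemer.
Context {R : realType} {d : nat}.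
Implicit Types (K L : convex_body R d) (C : closed_convex R d)
  (psi : convex_body R d -> R) (s : seq (R * convex_body R d)).

Lemma body_eq K L : body_set K = body_set L -> K = L.
Proof.
case: K L => [K cK vK] [L cL vL] /= KL; subst L.
by congr ConvexBody; exact: Prop_irrelevance.
Qed.

Lemma body_eq0 K : ~ (K !=set0) -> K = body0.
Proof.
by move=> K0; apply/body_eq/seteqP; split=> x // Kx; case: K0; exists x.
Qed.

Lemma empty_value psi K : psi body0 = 0 -> ~ (K !=set0) -> psi K = 0.
Proof. by move=> psi0 /body_eq0 ->. Qed.

Definition ccT : closed_convex R d :=
  ClosedConvex closedT (fun x y l _ _ => mem_set I).

Definition body_cc L : closed_convex R d :=
  ClosedConvex (compact_closed (@norm_hausdorff _ _) (@body_compact _ _ L))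
               (@body_convex _ _ L).

Lemma bodyIcA K C C' : bodyIc K (ccI C C') = bodyIc (bodyIc K C) C'.
Proof. by apply: body_eq; rewrite /= setIA. Qed.

Lemma bodyIcT K : bodyIc K ccT = K.
Proof. by apply: body_eq; rewrite /= setIT. Qed.

Lemma halfspace_closed (u : 'rV[R]_d) c : closed [set x | dot u x <= c].
Proof.
have cu : continuous (dot u).
  apply: (@dot_continuous _ _ (cst u) id) => x; [exact: cst_continuous|exact].
apply: (@closed_comp _ _ (dot u) [set r | r <= c]) => [x _|]; first exact: cu.
exact: closed_le.
Qed.

Lemma halfspace_convex (u : 'rV[R]_d) c : convex_set [set x | dot u x <= c].
Proof.
move=> x y l; rewrite !inE/= => ux uy; rewrite convE dotDr !dotZr.
have -> : c = l%:num * c + (1 - l%:num) * c by ring.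
by rewrite lerD// ler_wpM2l// subr_ge0.
Qed.

Definition halfspace u c :=
  ClosedConvex (@halfspace_closed u c) (@halfspace_convex u c).

(** The two closed half-spaces cover [K], so additivity applies to its two halves, which overlap in
    the slice by the hyperplane. *)
Lemma valuation_split psi K u c : valuation psi ->
  psi K = psi (bodyIc K (halfspace u c))
  + psi (bodyIc K (halfspace (- u) (- c)))
  - psi (bodyIc K (ccI (halfspace u c) (halfspace (- u) (- c)))).
Proof.
move=> [_ psiU]; set A := bodyIc K _; set B := bodyIc K _.
have AB : A `|` B = K :> set _.
  rewrite /= -setIUr; apply: setIidl => x _ /=.
  rewrite dotNl lerN2.
  by have [|/ltW] := leP (dot u x) c; [left|right].
have cAB : convex_set (A `|` B) by rewrite AB; exact: body_convex.
rewrite -(psiU _ _ cAB) (_ : bodyU cAB = K); last exact: body_eq.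
suff -> : bodyI A B = bodyIc K (ccI (halfspace u c) (halfspace (- u) (- c))).
  by rewrite addrK.
by apply: body_eq; rewrite /= setIACA setIid.
Qed.

(** A list stands for a formal linear combination of bodies. Repeated and empty bodies are allowed,
    since cutting may produce both. *)
Definition body_sum psi s : R := \sum_(q <- s) q.1 * psi q.2.

Definition restrict C s := [seq (q.1, bodyIc q.2 C) | q <- s].

Lemma restrict_ccI C C' s :
  restrict C' (restrict C s) = restrict (ccI C C') s.
Proof.
by rewrite /restrict -map_comp; apply: eq_map => q /=; rewrite bodyIcA.
Qed.

(** The hypothesis ranges over all closed convex sets that miss [L], so that it also covers pieces
    already cut by the previous half-spaces. *)
Lemma body_sum_sweep psi s L : VV R d psi ->
  (forall C, C `&` L = set0 -> body_sum psi (restrict C s) = 0) ->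
  body_sum psi (restrict (body_cc L) s) = body_sum psi s.
Proof.
move=> [vpsi cpsi] s0; have [u [c [Lu uL]]] := halfspaces L.
pose P := fix P n :=
  if n is m.+1 then ccI (P m) (halfspace (u m) (c m)) else ccT.
have sumP n : body_sum psi (restrict (P n) s) = body_sum psi s.
  elim: n => [|n <-] /=.
    rewrite /body_sum big_map; apply: eq_bigr => q _ /=; by rewrite bodyIcT.
  set H := halfspace (u n) (c n); set H' := halfspace (- u n) (- c n).
  have HL : H' `&` L = set0.
    apply/seteqP; split=> x //= -[]; rewrite dotNl lerN2.
    by rewrite leNgt => /negP + /(Lu n).
  (* The piece beyond the hyperplane and the slice in it both miss [L], so only the piece in [H]
     contributes. *)
  have := s0 (ccI (P n) H'); have := s0 (ccI (P n) (ccI H H')).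
  rewrite -!(restrict_ccI (P n)); set t := restrict (P n) s => + +.
  rewrite [body_sum psi t](_ : _ = body_sum psi (restrict H t)
    + body_sum psi (restrict H' t) - body_sum psi (restrict (ccI H H') t)).
    rewrite /= -!setIA HL !setI0 => -> // -> //.
    by rewrite addr0 subr0.
  rewrite /body_sum !big_map -big_split -sumrB; apply: eq_bigr => q _ /=.
  by rewrite (valuation_split _ (u n) (c n) vpsi) mulrBr mulrDr.
have PS n m : (n <= m)%N -> P m `<=` P n.
  move=> /subnK <-; elim: (m - n)%N => //= k IH x [+ _].
  exact: IH.
have PL : \bigcap_n P n = L.
  apply/seteqP; split=> x.
    move=> Px; apply: uL => n; exact: (Px n.+1 I).2.
  move=> Lx n _; elim: n => //= n Pn; split=> //=; exact/ltW/Lu.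
(* The sequence is constant by [sumP], hence equal to the limit that sigma-continuity gives along
   [P n] decreasing to [L]. *)
suff: body_sum psi (restrict (P n) s) @[n --> \oo] -->
    body_sum psi (restrict (body_cc L) s).
  under eq_fun do rewrite sumP.
  move=> /cvg_lim <- //; rewrite lim_cst//.
rewrite /body_sum big_map; under eq_fun do rewrite big_map.
apply: cvg_sumr => q; apply: cvgMr; apply: cpsi => /=.
  by move=> n m nm; apply: setIS; exact: PS.
rewrite -PL; apply/seteqP; split=> x.
  by move=> Px; split=> [|n _]; [have [] := Px 0%N I|have [] := Px n I].
by move=> [qx Px] n _; split=> //; exact: Px.
Qed.

Definition null_relation s := forall x, \sum_(q <- s) q.1 * \1_(q.2) x = 0.

Lemma null_relation_restrict C s :
  null_relation s -> null_relation (restrict C s).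
Proof.
move=> s0 x; rewrite big_map /=.
under eq_bigr do rewrite indicI mulrA.
by rewrite -mulr_suml s0 mul0r.
Qed.

Lemma groemer psi s : VV R d psi -> null_relation s -> body_sum psi s = 0.
Proof.
move=> Vpsi; have psi0 : psi body0 = 0 := Vpsi.1.1.
have [n] := ubnP (size s); elim: n s => // n IH [|[a A] s].
  by move=> _ _; rewrite /body_sum big_nil.
rewrite ltnS /= => sn s0.
(* A set [C] that misses [B] turns the first term into the empty body, and the induction hypothesis
   annihilates the rest. *)
have sweep b B t : (size t < n)%N -> null_relation ((b, B) :: t) ->
    body_sum psi (restrict (body_cc B) ((b, B) :: t))
    = body_sum psi ((b, B) :: t).
  move=> tn t0; apply: body_sum_sweep => // C CB.
  have BC : bodyIc B C = body0 by apply: body_eq; rewrite /= setIC CB.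
  rewrite /body_sum big_cons /= BC psi0 mulr0 add0r; apply: IH.
    by rewrite size_map.
  move=> x; have := null_relation_restrict C t0 x.
  by rewrite big_cons /= setIC CB indic0 mulr0 add0r.
rewrite -sweep//; have := null_relation_restrict (body_cc A) s0.
case: s => [|[b B] s] /= in sn s0 *.
  move=> /= A0; rewrite /body_sum big_seq1/=.
  (* In a relation with a single term, either the body has a point, which forces the coefficient to
     vanish, or it is empty. *)
  have [[x Ax]|/body_eq0 ->] := pselect (bodyIc A (body_cc A) !=set0).
    have := A0 x; rewrite big_seq1/= indicE mem_set// mulr1 => ->.
    by rewrite mul0r.
  by rewrite psi0 mulr0.
set A' := bodyIc A _; set B' := bodyIc B _; set t := restrict _ s => t0.
(* Bringing [B'] to the front allows a second sweep, after which the first two bodies both equal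
   [M]. *)
have t0' : null_relation ((b, B') :: (a, A') :: t).
  by move=> x; have := t0 x; rewrite !big_cons addrCA.
have tn : (size t < n.-1)%N by rewrite size_map; case: n sn {IH sweep}.
transitivity (body_sum psi ((b, B') :: (a, A') :: t)).
  by rewrite /body_sum !big_cons addrCA.
rewrite -sweep//; last by rewrite /= -ltn_predRL.
have /= := null_relation_restrict (body_cc B') t0'; set t' := restrict _ t.
have -> : bodyIc A' (body_cc B') = bodyIc B' (body_cc B').
  by apply/body_eq/seteqP; split=> x /=; tauto.
set M := bodyIc B' _ => M0.
(* Merging the two equal bodies shortens the relation by one term, so the induction hypothesis
   applies. *)
transitivity (body_sum psi ((a + b, M) :: t')).
  by rewrite /body_sum !big_cons /= addrA mulrDl [a * _ + _]addrC.
apply: IH => [|x]; first by rewrite /= size_map -ltn_predRL.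
by have := M0 x; rewrite !big_cons /= addrA mulrDl [a * _ + _]addrC.
Qed.

End Groemer.

(** * Cutting by a represented valuation, and independence of the representation *)

Section CutSums.
Context {R : realType} {d : nat}.
Implicit Types (K L : convex_body R d) (phi psi : convex_body R d -> R).

Section OneFamily.
Context {I : choiceType}.
Implicit Types (D : set I) (alpha : I -> R) (C : I -> closed_convex R d).

Definition hits D C K : set I := [set i | D i /\ (K `&` C i) !=set0].

Definition locally_finite D C := forall K, finite_set (hits D C K).

(** This is the product as computed from one chosen representation; with [euler] for [psi] it
    returns the represented valuation. The index type is arbitrary, to accommodate disjoint unions
    and products of families. *)
Definition cut_sum D alpha C psi K : R :=
  \sum_(i \in D) alpha i * psi (bodyIc K (C i)).

(** The index set depends on [L] only, so that the sums at all bodies inside [L] can be compared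
    term by term. *)
Lemma cut_sum_finite D alpha C psi K L :
  locally_finite D C -> psi body0 = 0 -> K `<=` L ->
  cut_sum D alpha C psi K
  = \sum_(i <- finmap.enum_fset (fset_set (hits D C L)))
      alpha i * psi (bodyIc K (C i)).
Proof.
move=> lfC psi0 KL; rewrite -fsbig_finite//; apply/esym/fsbig_widen.
  by move=> i [].
move=> i [Di Ci] /=; rewrite empty_value ?mulr0//.
by move=> [x [Kx Cx]]; apply: Ci; split=> //; exists x; split=> //; exact: KL.
Qed.

Lemma cut_sum_valuation D alpha C psi :
  locally_finite D C -> valuation psi -> valuation (cut_sum D alpha C psi).
Proof.
move=> lfC [psi0 psiU]; split=> [|K L KL].
  by rewrite /cut_sum fsbig1// => i _; rewrite empty_value ?mulr0// => -[x []].
have KU : K `<=` bodyU KL by left.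
have LU : L `<=` bodyU KL by right.
have IU : bodyI K L `<=` bodyU KL by move=> x [Kx _]; left.
rewrite !(@cut_sum_finite D alpha C psi _ (bodyU KL))//.
rewrite -!big_split; apply: eq_bigr => i _ /=; rewrite -!mulrDr; congr (_ * _).
have KLi : convex_set (bodyIc K (C i) `|` bodyIc L (C i)).
  by rewrite /= -setIUl; exact: (@body_convex _ _ (bodyIc (bodyU KL) (C i))).
rewrite -(psiU _ _ KLi); congr (psi _ + psi _); apply: body_eq => /=.
  by rewrite setIUl.
by rewrite setIACA setIid.
Qed.

Lemma cut_sum_sigma_continuous D alpha C psi :
  locally_finite D C -> psi body0 = 0 -> sigma_continuous psi ->
  sigma_continuous (cut_sum D alpha C psi).
Proof.
move=> lfC psi0 cpsi K_ K decr KE.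
have KK0 : K `<=` K_ 0%N by rewrite -KE => x; apply.
rewrite (cut_sum_finite _ lfC psi0 KK0).
under eq_fun => n do rewrite (cut_sum_finite _ lfC psi0 (decr _ _ (leq0n n))).
apply: cvg_sumr => i; apply: cvgMr; apply: cpsi => [n m nm|] /=.
  by apply: setSI; exact: decr.
rewrite -KE; apply/seteqP; split=> x.
  move=> Kx; split=> [n _|]; first by have [] := Kx n Logic.I.
  by have [] := Kx 0%N Logic.I.
by move=> [Kx Cx] n _; split=> //; exact: Kx.
Qed.

Lemma cut_sum_linear D alpha C a psi1 psi2 K :
  locally_finite D C -> psi1 body0 = 0 -> psi2 body0 = 0 ->
  cut_sum D alpha C (a *: psi1 + psi2) K
  = a * cut_sum D alpha C psi1 K + cut_sum D alpha C psi2 K.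
Proof.
move=> lfC psi10 psi20; have psi0 : (a *: psi1 + psi2) body0 = 0.
  transitivity (a * psi1 body0 + psi2 body0) => //.
  by rewrite psi10 psi20 mulr0 addr0.
rewrite !(@cut_sum_finite D alpha C _ K K)//.
rewrite mulr_sumr -big_split; apply: eq_bigr => i _ /=.
by rewrite mulrCA -mulrDr.
Qed.

Lemma euler0 : euler (@body0 R d) = 0.
Proof. by rewrite /euler asboolF// => -[]. Qed.

(** Through singletons, an equality of represented valuations becomes a linear relation between
    indicators, as [groemer] requires. *)
Lemma euler_indic (x : 'rV[R]_d) (A : closed_convex R d) :
  euler (bodyIc (body1 x) A) = \1_A x.
Proof.
rewrite indicE; congr (_%:R); congr nat_of_bool.
apply/asboolP/idP => [[y [-> Ay]]|/set_mem Ax]; first exact: mem_set.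
by exists x.
Qed.

Lemma cut_sum_point D alpha C psi x :
  locally_finite D C -> psi body0 = 0 ->
  cut_sum D alpha C psi (body1 x)
  = cut_sum D alpha C euler (body1 x) * psi (body1 x).
Proof.
move=> lfC psi0.
rewrite !(@cut_sum_finite D alpha C _ (body1 x) (body1 x)) ?euler0//.
rewrite mulr_suml; apply: eq_bigr => i _.
rewrite -mulrA; congr (_ * _); rewrite euler_indic indicE.
have [/set_mem Cx|/negP Cx] := boolP (x \in _).
  rewrite mul1r; congr psi; apply: body_eq; apply: setIidl => y ->; exact: Cx.
rewrite mul0r empty_value// => -[y [-> Cy]].
by apply: Cx; exact: mem_set.
Qed.

End OneFamily.

(** Equality of the two representations at singletons makes the difference of the indicator sums of
    the bodies K /\ C_i and K /\ C'_j vanish; [groemer] transfers this to [psi]. *)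
Lemma cut_sum_unique {I J : choiceType} (D : set I) (E : set J)
    (alpha : I -> R) (beta : J -> R) C C' phi psi :
  VV R d psi -> defined_by D alpha C phi -> defined_by E beta C' phi ->
  cut_sum D alpha C psi = cut_sum E beta C' psi.
Proof.
move=> Vpsi [_ lfC phiC] [_ lfC' phiC']; apply/funext => K.
have psi0 : psi body0 = 0 := Vpsi.1.1.
pose F := finmap.enum_fset (fset_set (hits D C K)).
pose G := finmap.enum_fset (fset_set (hits E C' K)).
rewrite (cut_sum_finite _ lfC psi0 (@subset_refl _ K)).
rewrite (cut_sum_finite _ lfC' psi0 (@subset_refl _ K)) -/F -/G.
pose s := [seq (alpha i, bodyIc K (C i)) | i <- F]
  ++ [seq (- beta j, bodyIc K (C' j)) | j <- G].
have : body_sum psi s = 0.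
  apply: groemer => // x; rewrite big_cat !big_map/=.
  under eq_bigr do rewrite indicI mulrCA; rewrite -mulr_sumr.
  under [X in _ + X]eq_bigr do rewrite indicI mulNr mulrCA.
  rewrite sumrN -mulr_sumr.
  have [Kx|Kx] := pselect (body_set K x); last first.
    by rewrite indicE memNset// !mul0r subrr.
  have xK : body1 x `<=` K by move=> y ->.
  have := phiC (body1 x); rewrite phiC'.
  rewrite -/(cut_sum _ _ _ _ _) -[RHS]/(cut_sum _ _ _ _ _).
  rewrite (cut_sum_finite _ lfC euler0 xK) (cut_sum_finite _ lfC' euler0 xK).
  under eq_bigr do rewrite euler_indic.
  under [RHS]eq_bigr do rewrite euler_indic.
  by move=> ->; rewrite subrr.
rewrite /body_sum big_cat !big_map/= => /eqP.
by under [X in _ + X]eq_bigr do rewrite mulNr; rewrite sumrN subr_eq0 => /eqP.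
Qed.

(* [countably_generated phi] only excludes the junk value of [product]: the
   representation by [I] need not be indexed by [nat]. *)
Lemma productE {I : choiceType} (D : set I) (alpha : I -> R) C phi psi :
  countably_generated phi -> VV R d psi -> defined_by D alpha C phi ->
  product phi psi = cut_sum D alpha C psi.
Proof.
move=> [N [beta [C' phiC']]] Vpsi phiC; apply/funext => K.
apply: xget_unique => [N1 gamma C1 phiC1|v /(_ _ _ _ phiC') ->].
  by rewrite (cut_sum_unique Vpsi phiC phiC1).
by rewrite (cut_sum_unique Vpsi phiC phiC').
Qed.

End CutSums.

(** * Reindexing, sums and products of representations *)

Section Representations.
Context {R : realType} {d : nat}.
Implicit Types (K L : convex_body R d) (phi psi : convex_body R d -> R).

Lemma countable_indices {T : choiceType} (D : set T) :
  countable D -> D !=set0 -> exists N (f : nat -> T), set_bij (indices N) D f.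
Proof.
(* [card_set_bijP] is applied over a pointed type, whose point is [i0]. *)
move=> cD [i0 _]; pose PT := HB.pack_for pointedType T (isPointed.Build T i0).
have [/finite_setP[n]|Dinf] := pselect (finite_set D).
  by rewrite card_eq_sym => /(@card_set_bijP _ PT)[f fbij]; exists (Some n), f.
have := eq_card_nat cD Dinf.
by rewrite card_eq_sym => /(@card_set_bijP _ PT)[f fbij]; exists None, f.
Qed.

Lemma countably_generatedP {T : choiceType} (D : set T) (alpha : T -> R) C phi :
  countable D -> defined_by D alpha C phi -> countably_generated phi.
Proof.
move=> cD [C0 lfC phiC]; have [D0|] := pselect (D !=set0); last first.
  move=> /set0P/negP/negPn/eqP D0; exists (Some 0%N), 0, (fun=> ccT).
  split=> // K; first by apply: (sub_finite_set (B := set0)) => // i [].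
  by rewrite phiC D0 !fsbig1.
have [N [f fbij]] := countable_indices cD D0; have [fD finj fsurj] := fbij.
exists N, (alpha \o f), (C \o f); split=> [n /fD|K|K].
- exact: C0.
(* An inverse [g] of [f] on [D] maps the finite set of members of the old family that meet [K] onto
   a set containing the corresponding new indices. *)
- have /choice[g gK] : forall i, exists n, D i -> indices N n /\ f n = i.
    move=> i; have [Di|nDi] := pselect (D i); last by exists 0%N.
    by have [n Nn <-] := fsurj _ Di; exists n.
  apply: (sub_finite_set _ (finite_image g (lfC K))) => n [Nn Cn].
  have Dn := fD _ Nn; exists (f n) => //.
  by have [Ngn fgn] := gK _ Dn; apply: finj => //; exact: mem_set.
- by rewrite phiC (reindex_fsbig f _ _ _ fbij).
Qed.

Section SumOfFamilies.
Context {I J : choiceType} (D : set I) (E : set J) (alpha : I -> R)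
  (beta : J -> R) (C : I -> closed_convex R d) (C' : J -> closed_convex R d).

(** A disjoint union of index sets represents a linear combination without interleaving two possibly
    infinite sequences. *)
Definition sum_set : set (I + J) := fun k =>
  match k with inl i => D i | inr j => E j end.

Definition sum_coef (a : R) (k : I + J) : R :=
  match k with inl i => a * alpha i | inr j => beta j end.

Definition sum_family (k : I + J) : closed_convex R d :=
  match k with inl i => C i | inr j => C' j end.

Lemma hits_sum K :
  hits sum_set sum_family K = inl @` hits D C K `|` inr @` hits E C' K.
Proof.
apply/seteqP; split=> [[i|j] ?|k [[i ? <-]|[j ? <-]]] //.
  by left; exists i.
by right; exists j.
Qed.

Lemma locally_finite_sum : locally_finite D C -> locally_finite E C' ->
  locally_finite sum_set sum_family.
Proof.
move=> lfC lfC' K; rewrite -/(hits _ _ _) hits_sum finite_setU.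
by split; exact: finite_image.
Qed.

Lemma cut_sum_sum a psi K : locally_finite D C -> locally_finite E C' ->
  psi body0 = 0 ->
  cut_sum sum_set (sum_coef a) sum_family psi K
  = a * cut_sum D alpha C psi K + cut_sum E beta C' psi K.
Proof.
move=> lfC lfC' psi0.
rewrite !(@cut_sum_finite _ _ _ _ _ _ _ K K)//; last exact: locally_finite_sum.
rewrite -!fsbig_finite//; last exact: locally_finite_sum.
rewrite hits_sum fsbigU0;
  [|exact: finite_image|exact: finite_image|]; last first.
  by move=> k [[i _ <-] [j _]].
rewrite !fsbig_image; [|by move=> ? ? _ _ []|by move=> ? ? _ _ []].
rewrite fsbig_distrr//; congr (_ + _); apply: eq_fsbigr => i _.
exact/esym/mulrA.
Qed.

Lemma defined_by_sum a phi1 phi2 :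
  defined_by D alpha C phi1 -> defined_by E beta C' phi2 ->
  defined_by sum_set (sum_coef a) sum_family (a *: phi1 + phi2).
Proof.
move=> [C0 lfC phi1C] [C'0 lfC' phi2C]; split.
- by move=> [i|j]; [exact: C0|exact: C'0].
- exact: locally_finite_sum.
move=> K; rewrite -/(cut_sum _ _ _ _ _) cut_sum_sum ?euler0//.
by rewrite /cut_sum -phi1C -phi2C.
Qed.

Definition prod_set : set (I * J) := [set k |
  [/\ D k.1, E k.2 & (C k.1 `&` C' k.2) !=set0]].

(** Cutting by C_i and then by C'_j is cutting by their intersection; local finiteness reduces both
    sides to finite sums. *)
Lemma cut_sum_prod psi K : locally_finite D C -> locally_finite E C' ->
  psi body0 = 0 ->
  \sum_(k \in D `*` E)
    alpha k.1 * beta k.2 * psi (bodyIc K (ccI (C k.1) (C' k.2)))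
  = cut_sum D alpha C (cut_sum E beta C' psi) K.
Proof.
move=> lfC lfC' psi0.
have cut0 : cut_sum E beta C' psi body0 = 0.
  by rewrite /cut_sum fsbig1// => j _; rewrite empty_value ?mulr0// => -[x []].
rewrite (@cut_sum_finite _ _ _ _ _ _ _ K K)// -fsbig_finite//.
(* The inner sum runs over the indices that hit [K], not its cut by [C i], so its range is
   independent of [i] and the double sum becomes a sum over pairs. *)
under eq_fsbigr => i _.
  rewrite (@cut_sum_finite _ _ _ E _ _ _ _ K)//; last by move=> x [].
  rewrite mulr_sumr -fsbig_finite//.
  over.
rewrite pair_fsbig//.
apply/esym; under eq_fsbigr do rewrite mulrA -bodyIcA.
apply: fsbig_widen => [[i j] [[Di _] [Ej _]]//|[i j] [[Di Ej]] /= hit].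
rewrite empty_value ?mulr0// => -[x [Kx [Cx C'x]]].
by apply: hit; split; split=> //; exists x.
Qed.

(** A pair whose intersection meets [K] has both members meeting [K], whence local finiteness. Pairs
    with empty intersection are dropped because their Euler terms vanish. *)
Lemma defined_by_prod phi psi :
  defined_by D alpha C phi -> defined_by E beta C' psi ->
  defined_by prod_set (fun k => alpha k.1 * beta k.2)
    (fun k => ccI (C k.1) (C' k.2)) (cut_sum D alpha C psi).
Proof.
move=> [_ lfC _] [_ lfC' psiC]; split.
- by move=> k [].
- move=> K; apply: (sub_finite_set _ (finite_setX (lfC K) (lfC' K))).
  move=> [i j] [[/= Di Ej _] [x [Kx [Cx C'x]]]].
  by split; split=> //; exists x.
move=> K; have -> : psi = cut_sum E beta C' euler by exact/funext.
rewrite -cut_sum_prod ?euler0//; apply/esym/fsbig_widen.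
  by move=> [i j] [].
move=> [i j] [[/= Di Ej] CC'].
rewrite empty_value ?euler0 ?mulr0// => -[x [_ [Cx C'x]]].
by apply: CC'; split=> //; exists x.
Qed.

End SumOfFamilies.

(** With both valuations expanded through [euler], each side is a sum over pairs, symmetric under
    exchanging the two indices. *)
Lemma cut_sumC {I J : choiceType} (D : set I) (E : set J)
    (alpha : I -> R) (beta : J -> R) C C' phi psi :
  defined_by D alpha C phi -> defined_by E beta C' psi ->
  cut_sum D alpha C psi = cut_sum E beta C' phi.
Proof.
move=> phiC psiC; have [_ lfC phiE] := phiC; have [_ lfC' psiE] := psiC.
apply/funext => K.
have -> : psi = cut_sum E beta C' euler by exact/funext.
have -> : phi = cut_sum D alpha C euler by exact/funext.
rewrite -!cut_sum_prod ?euler0//.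
pose swap (k : I * J) := (k.2, k.1).
rewrite (reindex_fsbig swap (D `*` E)) => [|]; last first.
  split=> [[i j] []|[i j] [i' j'] _ _ [-> ->]|[j i] [Ej Di]]//.
  by exists (i, j).
apply: eq_fsbigr => -[i j] _ /=; rewrite [beta _ * _]mulrC.
by congr (_ * euler _); apply: body_eq; rewrite /= [C' _ `&` _]setIC.
Qed.

Lemma indices1 : indices (Some 1%N) = [set 0%N].
Proof. by apply/seteqP; split=> i /=; rewrite ltnS leqn0 => /eqP. Qed.

Lemma defined_by_euler :
  defined_by (indices (Some 1%N)) (fun=> 1) (fun=> ccT) (@euler R d).
Proof.
split=> [i _|K|K].
- by exists 0.
- by apply: (sub_finite_set _ (finite_II 1)) => i [].
by rewrite indices1 fsbig_set1 mul1r bodyIcT.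
Qed.

End Representations.

(** * Linear combinations of valuations, and the final assembly *)

Lemma VV_linear (R : realType) (d : nat) (a : R) psi1 psi2 :
  VV R d psi1 -> VV R d psi2 -> VV R d (a *: psi1 + psi2).
Proof.
move=> [[z1 v1] c1] [[z2 v2] c2]; split; last first.
  move=> K_ K decr KE.
  by apply: cvgD; [apply: cvgMr; exact: c1|exact: c2].
have E K : (a *: psi1 + psi2) K = a * psi1 K + psi2 K by [].
split=> [|K L KL]; rewrite !E; first by rewrite z1 z2 mulr0 addr0.
by rewrite addrACA -mulrDr v1 v2 mulrDr addrACA.
Qed.

Theorem proposition5p2 (R : realType) (d : nat) (d_ge1 : (1 <= d)%N) :
  (forall K : convex_body R d,
    [/\ (* (i) *)
        (forall psi, VV R d psi ->
           forall (a : R) phi1 phi2, GG R d phi1 -> GG R d phi2 ->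
             product (a *: phi1 + phi2) psi K
             = a * product phi1 psi K + product phi2 psi K) /\
        (forall phi, GG R d phi ->
           forall (a : R) psi1 psi2, VV R d psi1 -> VV R d psi2 ->
             product phi (a *: psi1 + psi2) K
             = a * product phi psi1 K + product phi psi2 K),
        (* (ii) *)
        (forall phi psi, GG R d phi -> GG R d psi ->
           product phi psi K = product psi phi K) &
        (* (iii) *)
        (forall psi, VV R d psi -> product euler psi K = psi K)]) /\
  (forall phi psi, GG R d phi -> VV R d psi ->
    [/\ (* (iv) *)
        VV R d (product phi psi),
        (forall x : 'rV[R]_d,
           product phi psi (body1 x) = phi (body1 x) * psi (body1 x)) &
        (* (v) *)
        (GG R d psi ->
           GG R d (product phi psi) /\
           forall (N N' : option nat) (alpha alpha' : nat -> R)
             (C C' : nat -> closed_convex R d),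
             defined_by (indices N) alpha C phi ->
             defined_by (indices N') alpha' C' psi ->
             defined_by
               [set nm : nat * nat |
                 [/\ indices N nm.1, indices N' nm.2 &
                     (C nm.1 `&` C' nm.2) !=set0]]
               (fun nm => alpha nm.1 * alpha' nm.2)
               (fun nm => ccI (C nm.1) (C' nm.2))
               (product phi psi) /\
             forall K : convex_body R d,
               product phi psi K
               = \sum_(nm \in indices N `*` indices N')
                   alpha nm.1 * alpha' nm.2
                   * euler (bodyIc K (ccI (C nm.1) (C' nm.2))))]).
Proof.
have z psi : VV R d psi -> psi body0 = 0 by move=> [[]].
split=> [K|phi psi [Vphi gphi] Vpsi]; first split; [split|..].
- move=> psi Vpsi a phi1 phi2 [_ g1] [_ g2].
  have [N1 [alpha1 [C1 rep1]]] := g1; have [N2 [alpha2 [C2 rep2]]] := g2.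
  (* This representation is indexed by [nat + nat], hence the appeal to [countably_generatedP]
     before [productE] can use it. *)
  have rep := defined_by_sum a rep1 rep2.
  have g : countably_generated (a *: phi1 + phi2).
    by apply: countably_generatedP rep; exact: countableP.
  rewrite (productE g Vpsi rep) (productE g1 Vpsi rep1) (productE g2 Vpsi rep2).
  by case: rep1 rep2 => _ lf1 _ [_ lf2 _]; rewrite cut_sum_sum// z.
- move=> phi [_ g] a psi1 psi2 V1 V2; have [N [alpha [C rep]]] := g.
  rewrite (productE g (VV_linear a V1 V2) rep) (productE g V1 rep).
  by rewrite (productE g V2 rep) cut_sum_linear ?z//; case: rep.
- move=> phi psi [Vphi gphi] [Vpsi gpsi].
  have [N [alpha [C rep]]] := gphi; have [N' [alpha' [C' rep']]] := gpsi.
  rewrite (productE gphi Vpsi rep) (productE gpsi Vphi rep').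
  by rewrite (cut_sumC rep rep').
- move=> psi Vpsi.
  have g : countably_generated (@euler R d).
    exists (Some 1%N), (fun=> 1), (fun=> ccT); exact: defined_by_euler.
  rewrite (productE g Vpsi defined_by_euler) /cut_sum.
  by rewrite indices1 fsbig_set1 mul1r bodyIcT.
have [N [alpha [C rep]]] := gphi; have [_ lfC phiE] := rep.
have Vprod : VV R d (product phi psi).
  rewrite (productE gphi Vpsi rep); split.
    by apply: cut_sum_valuation => //; exact: Vpsi.1.
  by apply: cut_sum_sigma_continuous => //; [exact: z|exact: Vpsi.2].
split=> // [x|[_ gpsi]].
  rewrite (productE gphi Vpsi rep) cut_sum_point ?z//.
  by rewrite [phi _]phiE.
split=> [|{rep lfC phiE}N1 N' alpha1 alpha' C1 C' rep rep'].
  split=> //; have [N' [alpha' [C' rep']]] := gpsi.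
  have := defined_by_prod rep rep'; rewrite -(productE gphi Vpsi rep).
  by apply: countably_generatedP; exact: countableP.
rewrite (productE gphi Vpsi rep); split=> [|K].
  exact: (defined_by_prod rep rep').
have [_ lf1 _] := rep; have [_ lf' psiE] := rep'.
rewrite (cut_sum_prod _ _ _ lf1 lf' euler0); congr cut_sum.
exact/funext.
Qed.
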